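(* Let $a_1, a_2\in\mathbb{P}^2$ (over $\mathbb{C}$) be distinct points. Let $\mathcal{B}_1$ be the arrangement consisting of $n_1$ distinct lines passing through $a_1$, and let $\mathcal{B}_2$ be the arrangement consisting of $n_2$ distinct lines passing through $a_2$, such that $a_2$ lies on no line of $\mathcal{B}_1$ and $a_1$ lies on no line of $\mathcal{B}_2$, and let $\mathcal{A}'=\mathcal{B}_1\cup\mathcal{B}_2$. Assume that $3\leq n_1\leq n_2$. Let $L$ be a line such that the intersection $L\cap\mathcal{A}'$ consists of $n_1+n_2-1$ points. Then the arrangement $\mathcal{A}=\mathcal{A}'\cup L$ has type $2A$ with exponents $$(n_1+1,\ n_2+1,\ n_1+n_2-2).$$
   Context: A line arrangement is a finite set of distinct lines in $\mathbb{P}^2=\mathbb{P}^2_{\mathbb{C}}$, identified with the reduced curve given by their union. Let $S=\mathbb{C}[x,y,z]$ with its standard grading. For a reduced curve $C:f=0$ of degree $d$ in $\mathbb{P}^2$, let $$D_0(f)=\{(a,b,c)\in S^3 : af_x+bf_y+cf_z=0\}$$ be the graded $S$-module of Jacobian syzygies, where a homogeneous element $(a,b,c)$ has degree $k$ if $a,b,c$ are homogeneous of degree $k$. Let $d_1\leq d_2\leq\dots\leq d_m$ be the degrees of the elements of a minimal system of homogeneous generators of $D_0(f)$; $(d_1,\dots,d_m)$ are the exponents of $C$. The type of $C$ is $t(C)=d_1+d_2+1-d$. A curve of type $2$ has $m=3$ or $m=4$; it is said to be of type $2A$ if $m=3$ and of type $2B$ if $m=4$. *)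

(* Defs.v *)
From HB Require Import structures.
From mathcomp Require Import all_boot all_order all_algebra.
From mathcomp Require Import finmap.
From mathcomp Require Import mpoly.
From mathcomp Require Import complex.
From mathcomp Require Import reals.

Set Implicit Arguments.
Unset Strict Implicit.
Unset Printing Implicit Defensive.

Import GRing.Theory.
Local Open Scope ring_scope.

(* The points (resp. lines) of the projective plane over C are the subspaces of
   dimension 1 (resp. 2) of C^3, so that Leibniz equality is equality of points
   (resp. lines) and incidence is inclusion. *)
Definition ppoint (C : fieldType) := {U : {vspace 'rV[C]_3} | \dim U == 1%N}.
Definition pline (C : fieldType) := {U : {vspace 'rV[C]_3} | \dim U == 2%N}.

Definition on_line (C : fieldType) (p : ppoint C) (l : pline C) : bool :=
  (val p <= val l)%VS.

Definition on_arrangement (C : fieldType) (p : ppoint C) (A : {fset pline C}) :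
    Prop :=
  exists2 l, l \in A & on_line p l.

Definition line_equation (C : fieldType) (l : pline C) (h : {mpoly C[3]}) :
    Prop :=
  [/\ h \is 1.-homog, h != 0
    & forall v : 'rV[C]_3, v \in val l -> h.@[v 0] = 0].

(* f = 0 is the reduced union of the lines of A; such an f is unique up to a
   nonzero scalar. *)
Definition arrangement_equation (C : fieldType) (A : {fset pline C})
    (f : {mpoly C[3]}) : Prop :=
  exists2 h : pline C -> {mpoly C[3]},
    forall l, l \in A -> line_equation l (h l) & f = \prod_(l <- A) h l.

(* Membership in the module D_0(f). *)
Definition jacobian_syzygy (C : fieldType) (f : {mpoly C[3]})
    (a : 'rV[{mpoly C[3]}]_3) : Prop :=
  \sum_(i < 3) a 0 i * f^`M(i) = 0.

Definition homog_vec (C : fieldType) (k : nat) (a : 'rV[{mpoly C[3]}]_3) :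
    Prop :=
  forall i, a 0 i \is k.-homog.

Definition generates (C : fieldType) (D : 'rV[{mpoly C[3]}]_3 -> Prop)
    (m : nat) (g : 'I_m -> 'rV[{mpoly C[3]}]_3) (J : {set 'I_m}) : Prop :=
  forall a, D a <-> exists c : 'I_m -> {mpoly C[3]},
                      a = \sum_(i in J) c i *: g i.

Definition minimal_generators (C : fieldType)
    (D : 'rV[{mpoly C[3]}]_3 -> Prop) (m : nat)
    (g : 'I_m -> 'rV[{mpoly C[3]}]_3) : Prop :=
  generates D g [set: 'I_m] /\
  forall J : {set 'I_m}, J \proper [set: 'I_m] -> ~ generates D g J.

(* By the graded Nakayama lemma, the nondecreasing sequence ds of the degrees
   does not depend on the minimal system of homogeneous generators. *)
Definition has_exponents (C : fieldType) (f : {mpoly C[3]}) (ds : seq nat) :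
    Prop :=
  sorted leq ds /\
  exists2 g : 'I_(size ds) -> 'rV[{mpoly C[3]}]_3,
    minimal_generators (jacobian_syzygy f) g
    & forall i : 'I_(size ds), homog_vec (nth 0%N ds i) (g i).

(* (msize f).-1 is the degree of f. *)
Definition has_type (C : fieldType) (f : {mpoly C[3]}) (t : int) : Prop :=
  exists d1 d2 ds, has_exponents f [:: d1, d2 & ds] /\
    t = d1%:Z + d2%:Z + 1 - (msize f).-1%:Z.

Definition has_type_2A (C : fieldType) (f : {mpoly C[3]}) : Prop :=
  has_type f 2 /\ exists2 ds, has_exponents f ds & size ds = 3%N.

(* Main.v *)
Require Import Defs.
From HB Require Import structures.
From mathcomp Require Import all_boot all_order all_algebra.
From mathcomp Require Import finmap.
From mathcomp Require Import mpoly.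
From mathcomp Require Import complex.
From mathcomp Require Import reals.
From mathcomp Require Import zify ring.

Set Implicit Arguments.
Unset Strict Implicit.
Unset Printing Implicit Defensive.

Import GRing.Theory.
Local Open Scope ring_scope.

(** Besides the centres a1 and a2 of the two pencils, the arrangement has one
    further special point: counting the points of L shows that L avoids a1 and
    a2 and passes through exactly one intersection point o of a line l1 of the
    first pencil and a line l2 of the second (unique_triple_point).

    For each point v among a1, a2, o, let K_v be the product of the lines that
    miss v. The derivative d_v in the direction v kills the equations of the
    other lines, so K_v d_v f = f d_v(K_v). As the Euler field multiplies f by
    its degree, subtracting a multiple of it from K_v d_v gives a Jacobian
    syzygy of degree deg K_v (pencil_syzygy). These degrees are n1 + 1 for a2,
    n2 + 1 for a1 and n1 + n2 - 2 for o, and the three syzygies turn out to be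
    a minimal system of generators.

    They generate. Let x, y, z be the coordinates dual to the basis a1, a2, o.
    Then l2, l1, L are x = 0, y = 0, lam = 0 with lam a combination of x and y,
    and f = lam x y G H up to a constant, where the factors of G are forms in
    x, z and those of H are forms in y, z. A field theta that kills f is
    tangent to every line, that is, each linear factor l of f divides theta(l)
    (syzygy_logarithmic). A multiple of the Euler field makes theta(y) vanish.
    Tangency to l2 and L then gives theta(x) = x lam a, tangency to the lines
    of H gives theta(z) = H c, and tangency to the lines of G says that
    z lam a - H c is a multiple of G. Now z lam is a nonzerodivisor modulo
    (G, H): no line of G meets a line of H on z = 0, which joins a1 and a2, nor
    on L, where o is the only point common to both pencils. Hence a lies in (G, H), and solving for c
    expresses theta through the three fields K_v d_v and the Euler field
    (logarithmic_decomposition).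

    They are minimal because no relation between them has a unit coefficient:
    in coordinates a relation reads c_2 H = c_1 G, c_3 H = c_1 lam z and
    c_3 G = c_2 lam z, where c_1, c_2, c_3 belong to a1, a2, o, and evaluation
    at a1 and a2 excludes each c_j = 1.

    The commutative algebra rests on one fact: ideals generated by one or two
    independent linear forms are prime, since projecting along them maps the
    polynomial ring into itself with this ideal as kernel
    (project_along_eq0). *)

(** * Products of pairwise coprime primes in a domain *)

Section DomainAlgebra.

Variable S : idomainType.
Implicit Types (l g h p q s t w : S) (gs hs : seq S).

Definition divides l p := exists q, p = l * q.

Definition prime_element l :=
  l != 0 /\ forall p q, divides l (p * q) -> divides l p \/ divides l q.

Definition in_ideal2 l g s := exists u v, s = l * u + g * v.

Lemma prime_divides_prod l gs : prime_element l ->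
  (forall g, g \in gs -> ~ divides l g) ->
  forall s, divides l ((\prod_(g <- gs) g) * s) -> divides l s.
Proof.
move=> [_ lP]; elim: gs => [|g gs IH] ndiv s; first by rewrite big_nil mul1r.
rewrite big_cons -mulrA => /lP[/ndiv|]; first by rewrite mem_head => /(_ isT).
by apply: IH => g' g'gs; apply: ndiv; rewrite in_cons g'gs orbT.
Qed.

Lemma prod_primes_divides gs s : uniq gs ->
  {in gs, forall g, prime_element g} ->
  {in gs &, forall g g', g != g' -> ~ divides g g'} ->
  {in gs, forall g, divides g s} ->
  divides (\prod_(g <- gs) g) s.
Proof.
elim: gs s => [|g gs IH] s /=; first by exists s; rewrite big_nil mul1r.
move=> /andP[gNgs ugs] gsP ncop gss.
have gsub : {subset gs <= g :: gs} by move=> k kgs; rewrite in_cons kgs orbT.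
have [t sE] := gss g (mem_head _ _).
suff [u tE] : divides (\prod_(k <- gs) k) t.
  by exists u; rewrite big_cons sE tE mulrA.
apply: IH => // [k kgs|k k' kgs k'gs|k kgs].
- by apply: gsP; apply: gsub.
- by apply: ncop; apply: gsub.
have kNg : k != g by apply: contraNneq gNgs => <-.
have [|k_g|//] := (gsP k (gsub k kgs)).2 g t.
  by rewrite -sE; apply/gss/gsub.
by case: (ncop k g (gsub k kgs) (mem_head _ _) kNg).
Qed.

(** Both products are handled one factor at a time: an element of the ideal
    (l, g) modulo which h is cancelled is written as l u + g v, and then g is
    cancelled modulo the prime l. *)
Lemma cancel_prod_modulo l gs hs : prime_element l ->
  {in gs, forall g, ~ divides l g} ->
  {in gs & hs, forall g h s, in_ideal2 l g (h * s) -> in_ideal2 l g s} ->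
  forall s, in_ideal2 l (\prod_(g <- gs) g) ((\prod_(h <- hs) h) * s) ->
    in_ideal2 l (\prod_(g <- gs) g) s.
Proof.
move=> lP; elim: hs => [|h hs IHh] lg lgh s; first by rewrite big_nil mul1r.
have hsub : {subset hs <= h :: hs} by move=> k kh; rewrite in_cons kh orbT.
rewrite big_cons -mulrA => hH.
apply: IHh => // [g k ggs khs|]; first by apply: lgh => //; apply: hsub.
have {}lgh : {in gs, forall g s, in_ideal2 l g (h * s) -> in_ideal2 l g s}.
  by move=> g ggs; apply: lgh => //; apply: mem_head.
move: (_ * s) hH => {}s hsP {hsub}.
elim: gs lg lgh s hsP => [|g gs IHg] lg lgh s hsP.
  by exists 0, s; rewrite big_nil mulr0 add0r mul1r.
have gsub : {subset gs <= g :: gs} by move=> k kgs; rewrite in_cons kgs orbT.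
case: hsP => u [v]; rewrite big_cons => hsE.
have [s1 [s2 sE]] : in_ideal2 l g s.
  apply: (lgh g (mem_head _ _)); exists u, ((\prod_(k <- gs) k) * v).
  by rewrite hsE mulrA.
have [u2 [v2 s2E]] : in_ideal2 l (\prod_(k <- gs) k) s2.
  apply: IHg => [k kgs|k kgs|]; [exact/lg/gsub|exact/lgh/gsub|].
  have : divides l (g * (h * s2 - (\prod_(k <- gs) k) * v)).
    exists (u - h * s1).
    have -> : g * (h * s2 - (\prod_(k <- gs) k) * v)
      = h * s - h * l * s1 - (g * \prod_(k <- gs) k) * v by rewrite sE; ring.
    by rewrite hsE; ring.
  case/(lP.2) => [/lg|[w wE]]; first by rewrite mem_head => /(_ isT).
  by exists w, v; rewrite -wE; ring.
by exists (s1 + g * u2), v2; rewrite sE s2E; ring.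
Qed.

(** Modulo l the products H and G are coprime, so in a relation
    l w = H s + G t the pair (s, t) is, modulo l, a multiple of (G, - H).
    Subtracting that multiple leaves a pair divisible by l. *)
Lemma nonzero_divisor_modulo l gs hs : prime_element l ->
  {in gs, forall g, ~ divides l g} ->
  {in gs & hs, forall g h s, in_ideal2 l g (h * s) -> in_ideal2 l g s} ->
  forall w, in_ideal2 (\prod_(h <- hs) h) (\prod_(g <- gs) g) (l * w) ->
    in_ideal2 (\prod_(h <- hs) h) (\prod_(g <- gs) g) w.
Proof.
move=> lP lg lgh w [s [t lwE]]; have [l0 _] := lP.
set G := \prod_(g <- gs) g in lwE *; set H := \prod_(h <- hs) h in lwE *.
have [s1 [s2 sE]] : in_ideal2 l G s.
  apply: (cancel_prod_modulo lP lg lgh); exists w, (- t).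
  by rewrite -/G -/H lwE; ring.
have [k kE] : divides l (t + H * s2).
  apply: (prime_divides_prod lP lg); exists (w - H * s1).
  rewrite -/G; have -> : G * (t + H * s2) = (H * s + G * t) - H * l * s1.
    by rewrite sE; ring.
  by rewrite -lwE; ring.
exists s1, k; apply: (mulfI l0); rewrite lwE sE.
have -> : t = l * k - H * s2 by rewrite -kE; ring.
ring.
Qed.

(** Here a, b, c are the values on x, y, z of a field tangent to the lines with
    equations x, y, lam, g and h. The conclusion writes the field as u0 times
    the Euler field plus a combination of the fields x lam G d_x, y lam H d_y
    and G H d_z. The forms g and h enter through their coordinates, and the
    points they do not share through the cancellation hypotheses. *)
Lemma logarithmic_decomposition (x y z lam al be a b c : S) gs hs :
  let G := \prod_(g <- gs) g in let H := \prod_(h <- hs) h in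
  prime_element z -> prime_element lam ->
  lam = al * x + be * y -> ~ divides lam (al * x) ->
  uniq gs -> uniq hs ->
  {in gs, forall g, prime_element g} -> {in hs, forall h, prime_element h} ->
  {in gs &, forall g g', g != g' -> ~ divides g g'} ->
  {in hs &, forall h h', h != h' -> ~ divides h h'} ->
  {in gs & hs, forall g h, ~ divides g h} ->
  {in gs, forall g, ~ divides z g /\ ~ divides lam g} ->
  {in gs & hs, forall g h s, in_ideal2 z g (h * s) -> in_ideal2 z g s} ->
  {in gs & hs, forall g h s, in_ideal2 lam g (h * s) -> in_ideal2 lam g s} ->
  divides x a -> divides y b -> divides lam (al * a + be * b) ->
  {in gs, forall g, exists g1 g3,
    [/\ g = g1 * x + g3 * z, ~ divides g g3 & divides g (g1 * a + g3 * c)]} ->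
  {in hs, forall h, exists h2 h3,
    [/\ h = h2 * y + h3 * z, ~ divides h h3 & divides h (h2 * b + h3 * c)]} ->
  exists u0 u1 u2 u3, [/\ a = u0 * x + u1 * (x * lam * G),
    b = u0 * y + u2 * (y * lam * H) & c = u0 * z + u3 * (G * H)].
Proof.
move=> G H zP lamP lamE lamNx ugs uhs gsP hsP gsN hsN ghN gsNl Nz Nlam.
move=> [a' aE] [b' bE] [m abE] gsD hsD.
(* Subtracting b' times the Euler field makes the y-component vanish. *)
have [a'' a''E] : divides lam (a' - b').
  have : divides lam (al * x * (a' - b')).
    exists (m - b').
    have -> : al * x * (a' - b') = (al * a + be * b) - (al * x + be * y) * b'.
      by rewrite aE bE; ring.
    by rewrite abE -lamE; ring.
  by case/(lamP.2).
have [c' c'E] : divides H (c - b' * z).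
  apply: prod_primes_divides => // h hhs.
  have [h2 [h3 [hE hN [k kE]]]] := hsD h hhs.
  have : divides h (h3 * (c - b' * z)).
    exists (k - b').
    have -> : h3 * (c - b' * z) = (h2 * b + h3 * c) - (h2 * y + h3 * z) * b'.
      by rewrite bE; ring.
    by rewrite kE -hE; ring.
  by case/(hsP h hhs).2.
have a'D : a' = b' + lam * a'' by rewrite -a''E; ring.
have cD : c = b' * z + H * c' by rewrite -c'E; ring.
have [q qE] : divides G (z * lam * a'' - H * c').
  apply: prod_primes_divides => // g ggs.
  have [g1 [g3 [gE gN [k kE]]]] := gsD g ggs.
  have : divides g (g3 * (z * lam * a'' - H * c')).
    exists (a' - k).
    have -> : g3 * (z * lam * a'' - H * c') =
      (g1 * x + g3 * z) * a' - (g1 * a + g3 * c).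
      by rewrite aE cD a'D; ring.
    by rewrite kE -gE; ring.
  by case/(gsP g ggs).2.
(* Cancel lam and then z from z lam a'' = H c' + G q. *)
have [s [t a''D]] : in_ideal2 H G a''.
  apply: (nonzero_divisor_modulo lamP) => //; first by move=> g /gsNl[].
  apply: (nonzero_divisor_modulo zP) => //; first by move=> g /gsNl[].
  by exists c', q; rewrite -/G -/H -qE; ring.
have [u3 u3E] : divides G (c' - s * z * lam).
  have GD : divides G (H * (c' - s * z * lam)).
    exists (z * lam * t - q).
    have -> : H * (c' - s * z * lam)
      = z * lam * a'' - (z * lam * a'' - H * c') - H * s * z * lam by ring.
    by rewrite qE a''D; ring.
  apply: prod_primes_divides => // g ggs.
  apply: (prime_divides_prod (gsP g ggs) (gs := hs)) => [h|].
    exact: ghN.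
  case: GD => k ->; rewrite /G (big_rem g) //=; eexists; rewrite -mulrA.
  by [].
(* The y-component b' y now comes from u0 and u2 together: the multiple of the
   Euler field that produces the term H s of a'' is compensated by - s. *)
exists (b' + s * lam * H), t, (- s), u3.
have {}c'E : c' = s * z * lam + G * u3 by rewrite -u3E; ring.
split.
- by rewrite aE a'D a''D; ring.
- by rewrite bE; ring.
- by rewrite cD c'E; ring.
Qed.

End DomainAlgebra.

(** * Linear forms and the primes they generate *)

Section LinearForms.

Variables (C : fieldType) (n : nat).
Local Notation S := {mpoly C[n]}.
Implicit Types (l g h p q s : S) (u v w : 'rV[C]_n).

Definition linform u : S := \sum_i u 0 i *: 'X_i.

Lemma linformP l : l \is 1.-homog -> l = linform (\row_i l@_(U_(i))).
Proof.
move=> lH; apply/mpolyP => m.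
rewrite /linform raddf_sum /=.
under eq_bigr do rewrite mxE mcoeffZ mcoeffX.
have [/mdeg1P[i /eqP mE]|mN1] := boolP (mdeg m == 1%N).
  rewrite (bigD1 i) //= mE eqxx mulr1 big1 ?addr0 // => j ji.
  rewrite -mE; case: eqP => [/eqP|]; last by rewrite mulr0.
  by rewrite mE eq_mnm1 (negbTE ji).
rewrite (dhomog_nemf_coeff lH) // big1 // => i _.
by case: eqP => [mE|]; rewrite ?mulr0 //; rewrite -mE mdeg1 in mN1.
Qed.

Lemma meval_linform u v : (linform u).@[v 0] = \sum_i u 0 i * v 0 i.
Proof.
by rewrite /linform raddf_sum; apply: eq_bigr => i _; rewrite /= mevalZ mevalXU.
Qed.

Lemma linform_homog u : linform u \is 1.-homog.
Proof.
by apply: rpred_sum => i _; apply: rpredZ; rewrite dhomogX /= mdeg1.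
Qed.

Lemma meval_form_linear l a v w : l \is 1.-homog ->
  l.@[(a *: v + w) 0] = a * l.@[v 0] + l.@[w 0].
Proof.
move=> /linformP->; rewrite !meval_linform mulr_sumr -big_split.
by apply: eq_bigr => i _; rewrite !mxE /=; ring.
Qed.

Lemma meval_formZ l a v : l \is 1.-homog -> l.@[(a *: v) 0] = a * l.@[v 0].
Proof.
move=> /linformP->; rewrite !meval_linform mulr_sumr.
by apply: eq_bigr => i _; rewrite !mxE /=; ring.
Qed.

Lemma meval_form0 l : l \is 1.-homog -> l.@[(0 : 'rV[C]_n) 0] = 0.
Proof. by move=> lH; rewrite -(scale0r 0) meval_formZ ?mul0r. Qed.

(** The substitution X_i |-> X_i - v_i l - w_i g is the identity modulo (l, g),
    and when it kills l and g it is the projection onto a polynomial subring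
    along this ideal. That subring being a domain, (l, g) is prime. *)
Definition project_along l g v w p : S :=
  p \mPo [tuple 'X_i - v 0 i *: l - w 0 i *: g | i < n].

Lemma project_along_form l g v w h : h \is 1.-homog ->
  project_along l g v w h = h - h.@[v 0] *: l - h.@[w 0] *: g.
Proof.
move=> /linformP->; rewrite /project_along !meval_linform /linform.
rewrite raddf_sum /= !scaler_suml -!sumrB; apply: eq_bigr => i _.
rewrite comp_mpolyZ comp_mpolyXU.
by rewrite -tnth_nth tnth_mktuple !scalerBr !scalerA.
Qed.

Lemma project_along_congr l g v w p : in_ideal2 l g (p - project_along l g v w p).
Proof.
pose cong p := in_ideal2 l g (p - project_along l g v w p).
have congD q r : cong q -> cong r -> cong (q + r).
  move=> [a [b qE]] [a' [b' rE]]; exists (a + a'), (b + b').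
  rewrite /project_along rmorphD /= -!/(project_along _ _ _ _ _).
  by transitivity (q - project_along l g v w q + (r - project_along l g v w r));
    [|rewrite qE rE]; ring.
have congM q r : cong q -> cong r -> cong (q * r).
  move=> [a [b qE]] [a' [b' rE]].
  exists (a * r + project_along l g v w q * a'), (b * r + project_along l g v w q * b').
  rewrite /project_along rmorphM /= -!/(project_along _ _ _ _ _).
  transitivity ((q - project_along l g v w q) * r +
    project_along l g v w q * (r - project_along l g v w r)); first by ring.
  by rewrite qE rE; ring.
have congC c : cong c%:MP.
  by exists 0, 0; rewrite /project_along comp_mpolyC; ring.
have congX i : cong 'X_i.
  exists (v 0 i)%:MP, (w 0 i)%:MP.
  rewrite /project_along comp_mpolyXU -tnth_nth tnth_mktuple -!mul_mpolyC; ring.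
have cong1 : cong 1 by have := congC 1; rewrite mpolyC1.
rewrite -/(cong p); elim/(@mpolyind n C): p => [|c m p' _ _ pC].
  by have := congC 0; rewrite mpolyC0.
apply: congD => //; rewrite -mul_mpolyC; apply: (congM _ _ (congC c)).
rewrite mpolyXE_id; apply: (big_ind cong cong1 congM) => i _.
elim: (m i) => [|k IHk]; first by rewrite expr0.
by rewrite exprS; apply: congM.
Qed.

Lemma project_along_eq0 l g v w p :
  project_along l g v w l = 0 -> project_along l g v w g = 0 ->
  in_ideal2 l g p <-> project_along l g v w p = 0.
Proof.
move=> l0 g0; split=> [[a [b ->]]|p0]; last first.
  by rewrite -[p]subr0 -p0; apply: project_along_congr.
rewrite /project_along rmorphD !rmorphM /= -!/(project_along _ _ _ _ _).
by rewrite l0 g0 !mul0r addr0.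
Qed.

Lemma not_divides_point l p v : l.@[v 0] = 0 -> p.@[v 0] != 0 -> ~ divides l p.
Proof. by move=> l0 + [q pE]; rewrite pE mevalM l0 mul0r eqxx. Qed.

Lemma form_point l : l \is 1.-homog -> l != 0 -> exists v, l.@[v 0] = 1.
Proof.
move=> lH l0; have [i li] : exists i, l@_(U_(i)) != 0.
  apply/existsP; rewrite -negb_forall; apply: contra l0 => /forallP l0.
  rewrite (linformP lH) /linform big1 // => i _.
  by rewrite mxE (eqP (l0 i)) scale0r.
exists ((l@_(U_(i)))^-1 *: delta_mx 0 i); rewrite meval_formZ //.
rewrite [in X in _ * X](linformP lH) meval_linform (bigD1 i) //= big1 => [|j ji].
  by rewrite !mxE !eqxx mulr1 addr0 mulVf.
by rewrite !mxE (negbTE ji) mulr0.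
Qed.

(** Projection along l alone is the case g = 0, w = 0. *)
Lemma form_prime l : l \is 1.-homog -> l != 0 -> prime_element l.
Proof.
move=> lH l0; split=> // p q; have [v lv] := form_point lH l0.
have divE k : divides l k <-> project_along l 0 v 0 k = 0.
  rewrite -project_along_eq0.
  - split=> [[m ->]|[a [b ->]]]; first by exists m, 0; ring.
    by exists a; ring.
  - by rewrite project_along_form // lv scale1r scaler0 subrr subr0.
  - by rewrite /project_along comp_mpoly0.
rewrite !divE /project_along rmorphM /= => /eqP; rewrite mulf_eq0.
by case/orP => /eqP ->; [left|right].
Qed.

(** The projection along (l, g) does not change the value of h at a common zero
    u of l and g, so it does not kill h. The independence of l, g, h is given
    by points because the lines of an arrangement provide them. *)
Lemma cancel_form_modulo l g h u v w :
  l \is 1.-homog -> g \is 1.-homog -> h \is 1.-homog ->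
  l.@[u 0] = 0 -> g.@[u 0] = 0 -> h.@[u 0] != 0 ->
  l.@[v 0] != 0 -> g.@[v 0] = 0 -> l.@[w 0] = 0 -> g.@[w 0] != 0 ->
  forall s, in_ideal2 l g (h * s) -> in_ideal2 l g s.
Proof.
move=> lH gH hH lu gu hu lv gv lw gw s.
set v' := (l.@[v 0])^-1 *: v; set w' := (g.@[w 0])^-1 *: w.
have l0 : project_along l g v' w' l = 0.
  rewrite project_along_form // !meval_formZ // lw mulVf //.
  by rewrite mulr0 scale0r scale1r subrr subr0.
have g0 : project_along l g v' w' g = 0.
  rewrite project_along_form // !meval_formZ // gv mulVf //.
  by rewrite mulr0 scale0r scale1r subr0 subrr.
rewrite !(project_along_eq0 _ l0 g0) /project_along rmorphM /= => /eqP.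
rewrite mulf_eq0 => /orP[|/eqP//].
move=> /eqP/(congr1 (meval (u 0))); rewrite -/(project_along l g v' w' h).
rewrite project_along_form // !mevalB !mevalZ lu gu !mulr0 !subr0 meval0.
by move=> h0; rewrite h0 eqxx in hu.
Qed.

End LinearForms.

(** * Derivations with polynomial coefficients *)

Section Derivations.

Variables (C : fieldType) (n : nat).
Local Notation S := {mpoly C[n]}.
Implicit Types (l g h p q s : S) (u v w : 'rV[C]_n) (a b : 'rV[S]_n).

Definition deriv_along a p : S := \sum_i a 0 i * p^`M(i).

Definition const_field v : 'rV[S]_n := map_mx (@mpolyC n C) v.

Definition euler_field : 'rV[S]_n := \row_i 'X_i.

Lemma deriv_along_lin p a b q :
  deriv_along (p *: a + b) q = p * deriv_along a q + deriv_along b q.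
Proof.
rewrite /deriv_along mulr_sumr -big_split /=; apply: eq_bigr => i _.
by rewrite !mxE; ring.
Qed.

Lemma deriv_along0 p : deriv_along 0 p = 0.
Proof. by rewrite /deriv_along big1 // => i _; rewrite mxE mul0r. Qed.

Lemma deriv_alongD a b q :
  deriv_along (a + b) q = deriv_along a q + deriv_along b q.
Proof. by rewrite -[a]scale1r deriv_along_lin mul1r scale1r. Qed.

Lemma deriv_alongZ p a q : deriv_along (p *: a) q = p * deriv_along a q.
Proof. by rewrite -[p *: a]addr0 deriv_along_lin deriv_along0 addr0. Qed.

Lemma deriv_along_sum (I : finType) (P : pred I) (F : I -> 'rV[S]_n) q :
  deriv_along (\sum_(i | P i) F i) q = \sum_(i | P i) deriv_along (F i) q.
Proof.
apply: (big_morph (fun a => deriv_along a q)) => [a b|].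
  exact: deriv_alongD.
exact: deriv_along0.
Qed.

Lemma deriv_alongM a p q :
  deriv_along a (p * q) = deriv_along a p * q + p * deriv_along a q.
Proof.
rewrite /deriv_along mulr_suml mulr_sumr -big_split /=; apply: eq_bigr => i _.
by rewrite mderivM; ring.
Qed.

Lemma deriv_along1 a : deriv_along a 1 = 0.
Proof.
by rewrite /deriv_along big1 // => i _; rewrite -mpolyC1 mderivC mulr0.
Qed.

Lemma deriv_along_linform a u : deriv_along a (linform u) = \sum_i a 0 i * (u 0 i)%:MP.
Proof.
apply: eq_bigr => i _; congr (_ * _); rewrite /linform raddf_sum /=.
rewrite (bigD1 i) //= mderivZ mderivX mnm1E eqxx scale1r.
have -> : (U_(i) - U_(i) = 0)%MM by apply/mnmP => j; rewrite mnmBE subnn mnm0E.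
rewrite mpolyX0 big1 ?addr0 ?alg_mpolyC // => j ji.
by rewrite mderivZ mderivX mnm1E (negbTE ji) scale0r scaler0.
Qed.

Lemma deriv_const_form v l : l \is 1.-homog ->
  deriv_along (const_field v) l = (l.@[v 0])%:MP.
Proof.
move=> /linformP->; rewrite deriv_along_linform meval_linform raddf_sum /=.
by apply: eq_bigr => i _; rewrite mpolyCM !mxE mulrC.
Qed.

Lemma deriv_euler_form l : l \is 1.-homog -> deriv_along euler_field l = l.
Proof.
move=> /linformP->; rewrite deriv_along_linform; apply: eq_bigr => i _.
by rewrite [euler_field _ _]mxE mulrC mul_mpolyC.
Qed.

Lemma deriv_euler_prod (ls : seq S) : {in ls, forall l, l \is 1.-homog} ->
  deriv_along euler_field (\prod_(l <- ls) l) = (size ls)%:R * \prod_(l <- ls) l.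
Proof.
elim: ls => [|l ls IH] lsH; first by rewrite big_nil deriv_along1 mul0r.
rewrite big_cons deriv_alongM deriv_euler_form ?lsH ?mem_head // IH; last first.
  by move=> k kls; apply: lsH; rewrite in_cons kls orbT.
by rewrite -[size (l :: ls)]/((size ls).+1) -natr1; ring.
Qed.

Lemma deriv_const_prod v (ls : seq S) :
  {in ls, forall l, l \is 1.-homog /\ l.@[v 0] = 0} ->
  deriv_along (const_field v) (\prod_(l <- ls) l) = 0.
Proof.
elim: ls => [|l ls IH] lsH; first by rewrite big_nil deriv_along1.
have [lH lv] := lsH l (mem_head _ _).
rewrite big_cons deriv_alongM deriv_const_form // lv mpolyC0 IH; last first.
  by move=> k kls; apply: lsH; rewrite in_cons kls orbT.
by rewrite mul0r mulr0 addr0.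
Qed.

(** If the product is l k, the Leibniz rule turns its vanishing derivative into
    a multiple of l equal to theta(l) k, and the prime l does not divide k. *)
Lemma syzygy_logarithmic (a : 'rV[S]_n) (ls : seq S) : uniq ls ->
  {in ls, forall l, prime_element l} ->
  {in ls &, forall l k, l != k -> ~ divides l k} ->
  deriv_along a (\prod_(l <- ls) l) = 0 ->
  {in ls, forall l, divides l (deriv_along a l)}.
Proof.
move=> uls lsP lsN a0 l lls.
apply: (prime_divides_prod (lsP l lls) (gs := rem l ls)) => [k|].
  rewrite (mem_rem_uniq l uls) inE => /andP[kl kls].
  by apply: lsN; rewrite // eq_sym.
exists (- deriv_along a (\prod_(k <- rem l ls) k)).
move: a0; rewrite (big_rem l lls) /= deriv_alongM => /eqP.
by rewrite addr_eq0 => /eqP; rewrite mulrC => ->; ring.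
Qed.

(** * Coordinates in a basis *)

Variables (xs : 'I_n -> S) (vs : 'I_n -> 'rV[C]_n).
Hypothesis xs_homog : forall j, xs j \is 1.-homog.
Hypothesis xs_dual : forall j k, (xs j).@[vs k 0] = (j == k)%:R.

(** The matrices of the forms xs and of the vectors vs are inverse to each
    other. *)
Lemma field_coordinates a :
  a = \sum_j deriv_along a (xs j) *: const_field (vs j).
Proof.
pose V := \matrix_(j, i) vs j 0 i; pose U := \matrix_(i, j) (xs j)@_(U_(i)).
have xsE j : xs j = linform (row j U^T).
  by rewrite {1}(linformP (xs_homog j)); congr linform; apply/rowP=> i; rewrite !mxE.
have VU : V *m U = 1%:M.
  apply/matrixP => k j; rewrite !mxE eq_sym -xs_dual xsE meval_linform.
  by apply: eq_bigr => i _; rewrite !mxE mulrC.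
have UV : U *m V = 1%:M by apply: mulmx1C.
rewrite -[LHS]mulmx1 -(map_mx1 (@mpolyC n C)) -UV map_mxM mulmxA mulmx_sum_row.
apply: eq_bigr => j _; congr (_ *: _); last first.
  by apply/rowP => i; rewrite !mxE.
rewrite xsE deriv_along_linform !mxE; apply: eq_bigr => i _.
by rewrite !mxE.
Qed.

Lemma form_coordinates l : l \is 1.-homog ->
  l = \sum_j (l.@[vs j 0])%:MP * xs j.
Proof.
move=> lH; rewrite -[LHS]deriv_euler_form // (field_coordinates euler_field).
rewrite deriv_along_sum; apply: eq_bigr => j _.
by rewrite deriv_alongZ deriv_const_form // deriv_euler_form // mulrC.
Qed.

End Derivations.

(** * Syzygies from pencils of lines *)

Section PencilSyzygies.

Variable C : numFieldType.
Local Notation S := {mpoly C[3]}.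
Implicit Types (p q f K : S) (u v w : 'rV[C]_3) (a b : 'rV[S]_3).

Lemma mderiv_homog k p i : p \is k.+1.-homog -> p^`M(i) \is k.-homog.
Proof.
move=> /dhomogP pH; apply/dhomogP => m; rewrite mcoeff_msupp mcoeff_deriv.
move=> pm; have /pH : (m + U_(i))%MM \in msupp p.
  by rewrite mcoeff_msupp; apply: contra pm => /eqP->; rewrite mul0rn.
by rewrite /= mdegD mdeg1 addn1 => -[].
Qed.

Lemma prod_forms_homog (ls : seq S) : {in ls, forall l, l \is 1.-homog} ->
  \prod_(l <- ls) l \is (size ls).-homog.
Proof.
elim: ls => [|l ls IH] lsH; first by rewrite big_nil; apply: dhomog1.
rewrite big_cons -[size (l :: ls)]/(1 + size ls)%N; apply: dhomogM.
  by apply: lsH; rewrite mem_head.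
by apply: IH => k kls; apply: lsH; rewrite in_cons kls orbT.
Qed.

Lemma prod_forms_neq0 (ls : seq S) : {in ls, forall l, l != 0} ->
  \prod_(l <- ls) l != 0.
Proof. by move=> ls0; rewrite prodf_seq_neq0; apply/allP => l /ls0 ->. Qed.

Lemma msize_prod_forms (ls : seq S) : {in ls, forall l, l \is 1.-homog} ->
  {in ls, forall l, l != 0} -> msize (\prod_(l <- ls) l) = (size ls).+1.
Proof.
move=> lsH /prod_forms_neq0 p0; have pH := prod_forms_homog lsH.
rewrite -mlead_deg //; congr _.+1; apply: (dhomog_mf pH).
exact: mlead_supp.
Qed.

(** If K is the product of the lines that miss the point v, then K d_v f is the
    product of f and d_v K; subtracting the right multiple of the Euler field
    yields a Jacobian syzygy of f. *)
Definition pencil_syzygy (d : nat) K v : 'rV[S]_3 :=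
  K *: const_field v -
  ((d%:R^-1)%:MP * deriv_along (const_field v) K) *: euler_field C 3.

Lemma natr_inv_mpoly d : (0 < d)%N -> (d%:R^-1)%:MP * d%:R = 1 :> S.
Proof.
move=> d0; rewrite -[d%:R in X in _ * X]/(1 *+ d) -mpolyC1 -mpolyCMn -mpolyCM.
by rewrite mulVf // Num.Theory.pnatr_eq0 -lt0n.
Qed.

Lemma pencil_syzygy_homog d k K v : K \is k.+1.-homog ->
  homog_vec k.+1 (pencil_syzygy d K v).
Proof.
move=> KH i; rewrite !mxE; apply: rpredB.
  by rewrite mulrC mul_mpolyC rpredZ.
rewrite -mulrA mul_mpolyC rpredZ // -(addn1 k); apply: dhomogM.
  by apply: rpred_sum => j _; rewrite !mxE mul_mpolyC rpredZ // mderiv_homog.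
by rewrite dhomogX /= mdeg1.
Qed.

Section Generators.

Variables (xs Ks : 'I_3 -> S) (vs : 'I_3 -> 'rV[C]_3) (f : S) (d : nat).
Hypothesis xs_homog : forall j, xs j \is 1.-homog.
Hypothesis xs_dual : forall j k, (xs j).@[vs k 0] = (j == k)%:R.
Hypothesis d_gt0 : (0 < d)%N.
Hypothesis f_neq0 : f != 0.
Hypothesis f_euler : deriv_along (euler_field C 3) f = d%:R * f.
Hypothesis Ks_factor : forall j,
  exists2 M, f = Ks j * M & deriv_along (const_field (vs j)) M = 0.
Hypothesis syzygy_coordinates : forall a, jacobian_syzygy f a ->
  exists (u0 : S) (u : 'I_3 -> S),
    forall j, deriv_along a (xs j) = u0 * xs j + u j * Ks j.
Hypothesis no_unit_relation : forall (c : 'I_3 -> S) m i, c i = 1 ->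
  ~ (forall j, c j * Ks j = m * xs j).

Let gens i := pencil_syzygy d (Ks i) (vs i).

Lemma pencil_syzygyP i : jacobian_syzygy f (gens i).
Proof.
have [M fE M0] := Ks_factor i.
rewrite /jacobian_syzygy -/(deriv_along (gens i) f) /gens /pencil_syzygy.
rewrite -scaleNr deriv_alongD !deriv_alongZ f_euler {1}fE deriv_alongM M0.
set D := deriv_along _ (Ks i).
have -> : - ((d%:R^-1)%:MP * D) * (d%:R * f) = - ((d%:R^-1)%:MP * d%:R) * D * f.
  by ring.
by rewrite natr_inv_mpoly // fE; ring.
Qed.

Lemma pencil_syzygies_span : generates (jacobian_syzygy f) gens [set: 'I_3].
Proof.
move=> a; split=> [af|[c ->]]; last first.
  rewrite /jacobian_syzygy -/(deriv_along _ f) deriv_along_sum big1 // => i _.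
  by rewrite deriv_alongZ [X in _ * X]pencil_syzygyP mulr0.
have [u0 [u uE]] := syzygy_coordinates af.
pose m := u0 + \sum_i u i * ((d%:R^-1)%:MP * deriv_along (const_field (vs i)) (Ks i)).
have aE : a = m *: euler_field C 3 + \sum_i u i *: gens i.
  rewrite /m scalerDl scaler_suml -addrA -big_split /=.
  rewrite (field_coordinates xs_homog xs_dual a).
  rewrite [X in _ = _ *: X + _](field_coordinates xs_homog xs_dual).
  rewrite scaler_sumr -big_split; apply: eq_bigr => j _ /=.
  rewrite uE deriv_euler_form // /gens /pencil_syzygy scalerBr !scalerA.
  by rewrite [X in _ = _ + X]addrC subrK -scalerDl.
exists u; rewrite {1}aE.
suff -> : m = 0 by rewrite scale0r add0r; apply: eq_bigl => i; rewrite inE.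
have: deriv_along a f = 0 by [].
rewrite aE deriv_along_lin f_euler deriv_along_sum big1 => [|i _]; last first.
  by rewrite deriv_alongZ [X in _ * X]pencil_syzygyP mulr0.
move/eqP; rewrite addr0 !mulf_eq0 (negbTE f_neq0) orbF => /orP[/eqP//|].
move=> /eqP d0; have := natr_inv_mpoly d_gt0; rewrite d0 mulr0 => /eqP.
by rewrite eq_sym oner_eq0.
Qed.

(** A generator that the others express gives a relation in which its
    coefficient is 1. Applied to the coordinates xs j, this relation says that
    the c_j K_j are the components of a multiple of the Euler field. *)
Lemma pencil_syzygies_minimal : minimal_generators (jacobian_syzygy f) gens.
Proof.
split; first exact: pencil_syzygies_span.
move=> J /properP[_ [i _ iNJ]] /(_ (gens i))[/(_ (pencil_syzygyP i))[c giE] _].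
pose c' j := if j == i then 1 else if j \in J then - c j else 0.
have rel : \sum_j c' j *: gens j = 0.
  rewrite (bigD1 i) //= /c' eqxx scale1r giE big_mkcond /= [in X in X + _](bigD1 i) //=.
  rewrite (negbTE iNJ) add0r -big_split big1 //= => j ji.
  by rewrite (negbTE ji); case: ifP; rewrite ?scaleNr ?addrN // scale0r addr0.
pose m := \sum_j c' j * ((d%:R^-1)%:MP * deriv_along (const_field (vs j)) (Ks j)).
apply: (@no_unit_relation c' m i) => [|k]; first by rewrite /c' eqxx.
apply/eqP; rewrite -subr_eq0; apply/eqP.
rewrite -(deriv_along0 (xs k)) -rel deriv_along_sum.
transitivity (\sum_j (c' j * (Ks j * (k == j)%:R) -
   c' j * ((d%:R^-1)%:MP * deriv_along (const_field (vs j)) (Ks j)) * xs k)).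
  rewrite sumrB -mulr_suml -/m; congr (_ - _).
  rewrite (bigD1 k) //= eqxx mulr1 big1 ?addr0 // => j jk.
  by rewrite eq_sym (negbTE jk) !mulr0.
apply: eq_bigr => j _; rewrite deriv_alongZ /gens /pencil_syzygy -scaleNr.
rewrite deriv_alongD !deriv_alongZ (deriv_const_form _ (xs_homog k)).
rewrite deriv_euler_form //.
by rewrite xs_dual raddfMn /= mpolyC1; ring.
Qed.

End Generators.
End PencilSyzygies.

(** * Two pencils and a line through exactly one of their intersection points *)

Section TwoPencils.

Variable C : numFieldType.
Local Notation S := {mpoly C[3]}.

(** The coordinate z exists because the values of x and y already show that
    v1, v2, v3 are independent. *)
Lemma dual_form (x y : S) (v1 v2 v3 : 'rV[C]_3) :
  x \is 1.-homog -> y \is 1.-homog ->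
  x.@[v1 0] != 0 -> x.@[v2 0] = 0 -> x.@[v3 0] = 0 ->
  y.@[v1 0] = 0 -> y.@[v2 0] != 0 -> y.@[v3 0] = 0 -> v3 != 0 ->
  exists z : S, [/\ z \is 1.-homog, z.@[v1 0] = 0, z.@[v2 0] = 0 & z.@[v3 0] = 1].
Proof.
move=> xH yH x1 x2 x3 y1 y2 y3 v30.
pose V : 'M[C]_3 := \matrix_(i, j) [:: v1; v2; v3]`_i 0 j.
have rowV i : row i V = [:: v1; v2; v3]`_i by apply/rowP => j; rewrite !mxE.
have Vu : V \in unitmx.
  rewrite -row_free_unit; apply: inj_row_free => c.
  rewrite mulmx_sum_row !big_ord_recl big_ord0 !rowV /= addr0.
  set c1 := c 0 _; set c2 := c 0 _; set c3 := c 0 _ => cV0.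
  have form0 l : l \is 1.-homog ->
      c1 * l.@[v1 0] + (c2 * l.@[v2 0] + c3 * l.@[v3 0]) = 0.
    move=> lH; rewrite -(meval_formZ c3) // -!meval_form_linear // cV0.
    exact: meval_form0.
  have c10 : c1 = 0.
    have /eqP := form0 x xH; rewrite x2 x3 !mulr0 !addr0 mulf_eq0 (negbTE x1) orbF.
    by move/eqP.
  have c20 : c2 = 0.
    have /eqP := form0 y yH; rewrite y1 y3 !mulr0 addr0 add0r mulf_eq0 (negbTE y2).
    by rewrite orbF => /eqP.
  move: cV0; rewrite c10 c20 !scale0r !add0r => /eqP; rewrite scaler_eq0.
  rewrite (negbTE v30) orbF => /eqP c30.
  apply/rowP => i; rewrite mxE; case: i => [[|[|[|//]]] ilt].
  - by rewrite -[RHS]c10; congr (c 0 _); apply: val_inj.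
  - by rewrite -[RHS]c20; congr (c 0 _); apply: val_inj.
  - by rewrite -[RHS]c30; congr (c 0 _); apply: val_inj.
pose z := linform (row ord_max (invmx V)^T).
have zE (i : 'I_3) : z.@[[:: v1; v2; v3]`_i 0] = (i == ord_max)%:R.
  have := congr1 (fun M : 'M_3 => M i ord_max) (mulmxV Vu).
  rewrite !mxE => <-; rewrite meval_linform; apply: eq_bigr => j _.
  by rewrite !mxE mulrC.
exists z; split; first exact: linform_homog.
- exact: (zE ord0).
- exact: (zE (lift ord0 ord0)).
- exact: (zE ord_max).
Qed.

Section NormalizedPencils.

Variables (x y z lam : S) (gs hs : seq S) (v1 v2 v3 : 'rV[C]_3).

Let xs (j : 'I_3) := [:: y; x; z]`_j.
Let vs (j : 'I_3) := [:: v2; v1; v3]`_j.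
Let lines := [:: lam, x, y & gs ++ hs].

Hypothesis z_homog : z \is 1.-homog.
Hypothesis lines_homog : {in lines, forall l, l \is 1.-homog}.
Hypothesis lines_uniq : uniq lines.
Hypothesis lines_distinct : {in lines &, forall l k, l != k ->
  exists2 v : 'rV[C]_3, l.@[v 0] = 0 & k.@[v 0] != 0}.
Hypothesis xs_dual : forall j k, (xs j).@[vs k 0] = (j == k)%:R.
Hypothesis lam1 : lam.@[v1 0] != 0.
Hypothesis lam2 : lam.@[v2 0] != 0.
Hypothesis lam3 : lam.@[v3 0] = 0.
Hypothesis gsP : {in gs, forall g,
  [/\ g.@[v1 0] != 0, g.@[v2 0] = 0 & g.@[v3 0] != 0]}.
Hypothesis hsP : {in hs, forall h,
  [/\ h.@[v1 0] = 0, h.@[v2 0] != 0 & h.@[v3 0] != 0]}.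
Hypothesis gs_gt0 : (0 < size gs)%N.
Hypothesis hs_gt0 : (0 < size hs)%N.
Hypothesis generic : {in gs & hs, forall g h,
  exists v : 'rV[C]_3, [/\ lam.@[v 0] = 0, g.@[v 0] = 0 & h.@[v 0] != 0]}.

Let G := \prod_(g <- gs) g.
Let H := \prod_(h <- hs) h.
Let f := \prod_(l <- lines) l.
Let Ks (j : 'I_3) := [:: y * lam * H; x * lam * G; G * H]`_j.

Let i0 : 'I_3 := ord0.
Let i1 : 'I_3 := lift ord0 ord0.
Let i2 : 'I_3 := ord_max.

Let ord3P (P : 'I_3 -> Prop) : P i0 -> P i1 -> P i2 -> forall j, P j.
Proof.
move=> P0 P1 P2 [[|[|[|//]]] jlt].
- by rewrite (_ : Ordinal _ = i0) //; apply: val_inj.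
- by rewrite (_ : Ordinal _ = i1) //; apply: val_inj.
- by rewrite (_ : Ordinal _ = i2) //; apply: val_inj.
Qed.

Let sum3 (F : 'I_3 -> S) : \sum_j F j = F i0 + F i1 + F i2.
Proof.
rewrite !big_ord_recl big_ord0 addr0 addrA.
by congr (_ + F _); apply: val_inj.
Qed.

Let fE : f = lam * (x * (y * (G * H))).
Proof. by rewrite /f /lines !big_cons big_cat. Qed.

Let lam_in : lam \in lines. Proof. exact: mem_head. Qed.
Let x_in : x \in lines. Proof. by rewrite !inE eqxx orbT. Qed.
Let y_in : y \in lines. Proof. by rewrite !inE eqxx !orbT. Qed.
Let gs_in : {subset gs <= lines}.
Proof. by move=> g ggs; rewrite !inE mem_cat ggs !orbT. Qed.
Let hs_in : {subset hs <= lines}.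
Proof. by move=> g ghs; rewrite !inE mem_cat ghs !orbT. Qed.

Let xs_homog j : xs j \is 1.-homog.
Proof. by elim/ord3P: j => //; apply: lines_homog. Qed.

Let lines_neq0 l : l \in lines -> l != 0.
Proof.
rewrite !inE mem_cat => /or4P[/eqP->|/eqP->|/eqP->|/orP[/gsP|/hsP][]].
- by apply: contraNneq lam1 => ->; rewrite meval0.
- apply: contraTneq isT => x0; have := xs_dual i1 i1.
  by rewrite /xs /= x0 meval0 => /eqP; rewrite eq_sym oner_eq0.
- apply: contraTneq isT => y0; have := xs_dual i0 i0.
  by rewrite /xs /= y0 meval0 => /eqP; rewrite eq_sym oner_eq0.
- by move=> + _ _; apply: contraNneq => ->; rewrite meval0.
- by move=> _ + _; apply: contraNneq => ->; rewrite meval0.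
Qed.

Let lines_prime l : l \in lines -> prime_element l.
Proof. by move=> ll; apply: form_prime; [apply: lines_homog|apply: lines_neq0]. Qed.

Let lines_ndiv : {in lines &, forall l k, l != k -> ~ divides l k}.
Proof.
move=> l k ll kl lk; have [v lv kv] := lines_distinct ll kl lk.
exact: not_divides_point lv kv.
Qed.

Let form3 l : l \is 1.-homog ->
  l = (l.@[v1 0])%:MP * x + (l.@[v2 0])%:MP * y + (l.@[v3 0])%:MP * z.
Proof.
by move=> lH; rewrite {1}(form_coordinates xs_homog xs_dual lH) sum3 /xs /vs /=; ring.
Qed.

Let x1 : x.@[v1 0] = 1. Proof. exact: (xs_dual i1 i1). Qed.
Let x2 : x.@[v2 0] = 0. Proof. exact: (xs_dual i1 i0). Qed.
Let x3 : x.@[v3 0] = 0. Proof. exact: (xs_dual i1 i2). Qed.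
Let y1 : y.@[v1 0] = 0. Proof. exact: (xs_dual i0 i1). Qed.
Let y2 : y.@[v2 0] = 1. Proof. exact: (xs_dual i0 i0). Qed.
Let y3 : y.@[v3 0] = 0. Proof. exact: (xs_dual i0 i2). Qed.
Let z1 : z.@[v1 0] = 0. Proof. exact: (xs_dual i2 i1). Qed.
Let z2 : z.@[v2 0] = 0. Proof. exact: (xs_dual i2 i0). Qed.
Let z3 : z.@[v3 0] = 1. Proof. exact: (xs_dual i2 i2). Qed.

Let z_neq0 : z != 0.
Proof.
by apply: contra_eq_neq z3 => ->; rewrite meval0 eq_sym oner_neq0.
Qed.

Let cancel_mod_z :
  {in gs & hs, forall g h s, in_ideal2 z g (h * s) -> in_ideal2 z g s}.
Proof.
move=> g h ggs hhs; have [g1 g2 g3] := gsP ggs; have [h1 h2 h3] := hsP hhs.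
have gH : g \is 1.-homog by apply: lines_homog; apply: gs_in.
(* The point g(v3) v1 - g(v1) v3 is the intersection of g with y = 0. *)
apply: (@cancel_form_modulo _ _ z g h v2
  (g.@[v3 0] *: v1 + - g.@[v1 0] *: v3) v1) => //.
- by apply: lines_homog; apply: hs_in.
- by rewrite meval_form_linear // meval_formZ // z1 z3 mulr0 mulr1 add0r oppr_eq0.
- by rewrite meval_form_linear // meval_formZ // mulNr mulrC subrr.
Qed.

Let cancel_mod_lam :
  {in gs & hs, forall g h s, in_ideal2 lam g (h * s) -> in_ideal2 lam g s}.
Proof.
move=> g h ggs hhs; have [g1 g2 g3] := gsP ggs.
have [v [lv gv hv]] := generic ggs hhs.
by apply: (@cancel_form_modulo _ _ lam g h v v2 v3) => //;
  apply: lines_homog => //; [apply: gs_in|apply: hs_in].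
Qed.

Let lam_ndiv_x c : c != 0 -> ~ divides lam (c%:MP * x).
Proof.
move=> c0.
(* The intersection of lam with the line z = 0 through v1 and v2. *)
pose v := lam.@[v2 0] *: v1 + - lam.@[v1 0] *: v2.
have lamH : lam \is 1.-homog by apply: lines_homog.
have xH : x \is 1.-homog by apply: lines_homog.
apply: (@not_divides_point _ _ _ _ v).
  by rewrite meval_form_linear // meval_formZ // mulNr mulrC subrr.
rewrite mevalM mevalC meval_form_linear // meval_formZ // x1 x2 mulr0 addr0 mulr1.
by rewrite mulf_neq0.
Qed.

Let ndiv_const l c : l \in lines -> c != 0 -> ~ divides l c%:MP.
Proof.
move=> ll c0; apply: (@not_divides_point _ _ _ _ 0); last by rewrite mevalC.
by apply: meval_form0; apply: lines_homog.
Qed.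

Lemma syzygy_coordinates a : jacobian_syzygy f a ->
  exists (u0 : S) (u : 'I_3 -> S),
    forall j, deriv_along a (xs j) = u0 * xs j + u j * Ks j.
Proof.
move=> af; have tangent := syzygy_logarithmic lines_uniq lines_prime lines_ndiv af.
move: lines_uniq; rewrite /= !inE mem_cat cat_uniq => /and4P[_ _ _ /and3P[ugs _ uhs]].
have lamH : lam \is 1.-homog by apply: lines_homog.
have deriv3 l : l \is 1.-homog -> deriv_along a l =
    (l.@[v1 0])%:MP * deriv_along a x + (l.@[v2 0])%:MP * deriv_along a y
     + (l.@[v3 0])%:MP * deriv_along a z.
  move=> lH; rewrite {1}(form3 lH).
  have derC c p : deriv_along a (c%:MP * p) = c%:MP * deriv_along a p.
    rewrite /deriv_along mulr_sumr; apply: eq_bigr => i _.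
    by rewrite mderiv_mulC; ring.
  have derD p q : deriv_along a (p + q) = deriv_along a p + deriv_along a q.
    rewrite /deriv_along -big_split; apply: eq_bigr => i _.
    by rewrite mderivD mulrDr.
  by rewrite !derD !derC.
have [|||||||||||||||||||u0 [u1 [u2 [u3 [xE yE zE]]]]] :=
  @logarithmic_decomposition _ x y z lam (lam.@[v1 0])%:MP (lam.@[v2 0])%:MP
    (deriv_along a x) (deriv_along a y) (deriv_along a z) gs hs.
all: try by [].
- exact: form_prime.
- exact: lines_prime.
- by rewrite {1}(form3 lamH) lam3 mpolyC0 mul0r addr0.
- exact: lam_ndiv_x.
- by move=> g /gs_in/lines_prime.
- by move=> h /hs_in/lines_prime.
- by move=> g g' /gs_in gl /gs_in g'l; apply: lines_ndiv.
- by move=> h h' /hs_in hl /hs_in h'l; apply: lines_ndiv.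
- move=> g h /gsP[_ g2 _] /hsP[_ h2 _]; exact: not_divides_point g2 h2.
- move=> g /gsP[g1 _ g3]; split; first exact: not_divides_point z1 g1.
  exact: not_divides_point lam3 g3.
- exact: tangent.
- exact: tangent.
- have := tangent _ lam_in; rewrite (deriv3 _ lamH) lam3 mpolyC0 mul0r addr0.
  by [].
- move=> g ggs; have [g1 g2 g3] := gsP ggs; have gl := gs_in ggs.
  exists (g.@[v1 0])%:MP, (g.@[v3 0])%:MP; split.
  + by rewrite {1}(form3 (lines_homog gl)) g2 mpolyC0 mul0r addr0.
  + exact: ndiv_const.
  + have := tangent _ gl; rewrite deriv3; last exact: lines_homog.
    by rewrite g2 mpolyC0 mul0r addr0.
- move=> h hhs; have [h1 h2 h3] := hsP hhs; have hl := hs_in hhs.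
  exists (h.@[v2 0])%:MP, (h.@[v3 0])%:MP; split.
  + by rewrite {1}(form3 (lines_homog hl)) h1 mpolyC0 mul0r add0r.
  + exact: ndiv_const.
  + have := tangent _ hl; rewrite deriv3; last exact: lines_homog.
    by rewrite h1 mpolyC0 mul0r add0r.
exists u0, (fun j : 'I_3 => [:: u2; u1; u3]`_j).
apply: ord3P; [exact: yE | exact: xE | exact: zE].
Qed.

Let meval_prod_neq0 (ls : seq S) (v : 'rV[C]_3) :
  {in ls, forall l, l.@[v 0] != 0} -> (\prod_(l <- ls) l).@[v 0] != 0.
Proof.
move=> lsv; rewrite rmorph_prod /= prodf_seq_neq0; apply/allP => l /lsv ->.
by [].
Qed.

Let meval_prod_eq0 (ls : seq S) (v : 'rV[C]_3) : (0 < size ls)%N ->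
  {in ls, forall l, l.@[v 0] = 0} -> (\prod_(l <- ls) l).@[v 0] = 0.
Proof.
case: ls => // l ls _ lsv; rewrite big_cons mevalM lsv ?mem_head ?mul0r //.
Qed.

Let G1 : G.@[v1 0] != 0. Proof. by apply: meval_prod_neq0 => g /gsP[]. Qed.
Let G2 : G.@[v2 0] = 0. Proof. by apply: meval_prod_eq0 => // g /gsP[]. Qed.
Let H1 : H.@[v1 0] = 0. Proof. by apply: meval_prod_eq0 => // h /hsP[]. Qed.
Let H2 : H.@[v2 0] != 0. Proof. by apply: meval_prod_neq0 => h /hsP[]. Qed.

(** The relation gives c_0 H = c_1 G and c_2 H = c_1 lam z. At v1 the form H
    vanishes and G does not; at v2 the forms G and z vanish and H does not. *)
Lemma no_unit_relation (c : 'I_3 -> S) m i : c i = 1 ->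
  ~ (forall j, c j * Ks j = m * xs j).
Proof.
move=> ci rel; have := (rel i0, rel i1, rel i2); rewrite /Ks /xs /=.
move=> [[rel0 rel1] rel2].
have nz l : l \in lines -> l != 0 by exact: lines_neq0.
have mE0 : c i0 * lam * H = m.
  by apply: (mulfI (nz y y_in)); rewrite [RHS]mulrC -rel0; ring.
have mE1 : c i1 * lam * G = m.
  by apply: (mulfI (nz x x_in)); rewrite [RHS]mulrC -rel1; ring.
have cHG : c i0 * H = c i1 * G.
  apply: (mulfI (nz lam lam_in)); transitivity m; first by rewrite -mE0; ring.
  by rewrite -mE1; ring.
have G0 : G != 0 by apply: contraNneq G1 => ->; rewrite meval0.
have cHz : c i2 * H = c i1 * lam * z.
  by apply: (mulfI G0); rewrite mulrCA rel2 -mE1; ring.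
elim/ord3P: i ci => ci.
- move/(congr1 (meval (v2 0))): cHG; rewrite ci mul1r mevalM G2 mulr0.
  exact/eqP.
- move/(congr1 (meval (v1 0))): cHG; rewrite ci mul1r mevalM H1 mulr0.
  by move/esym; apply/eqP.
- move/(congr1 (meval (v2 0))): cHz; rewrite ci mul1r !mevalM z2 mulr0.
  exact/eqP.
Qed.

Lemma normalized_pencils_exponents : (size hs <= size gs)%N -> (2 <= size hs)%N ->
  has_exponents f [:: (size hs).+2; (size gs).+2; (size gs + size hs)%N].
Proof.
move=> hg h2; split; first by rewrite /= !ltnS hg /= -addn2 leq_add2l h2.
have gsH : {in gs, forall g, g \is 1.-homog} by move=> g /gs_in/lines_homog.
have hsH : {in hs, forall g, g \is 1.-homog} by move=> g /hs_in/lines_homog.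
exists (fun i => pencil_syzygy (size lines) (Ks i) (vs i)).
  apply: (pencil_syzygies_minimal (xs := xs)) => //.
  - exact: prod_forms_neq0.
  - exact: deriv_euler_prod.
  - apply: ord3P.
    + exists (\prod_(l <- x :: gs) l).
        by rewrite fE /Ks /= big_cons -/G; ring.
      apply: deriv_const_prod => l; rewrite inE => /predU1P[->|lgs].
        by split; rewrite ?lines_homog.
      by split; [apply: gsH|case: (gsP lgs)].
    + exists (\prod_(l <- y :: hs) l).
        by rewrite fE /Ks /= big_cons -/H; ring.
      apply: deriv_const_prod => l; rewrite inE => /predU1P[->|lhs].
        by split; rewrite ?lines_homog.
      by split; [apply: hsH|case: (hsP lhs)].
    + exists (\prod_(l <- [:: lam; x; y]) l).
        by rewrite fE /Ks /= !big_cons big_nil; ring.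
      apply: deriv_const_prod => l.
      by rewrite !inE => /or3P[] /eqP->; split; rewrite ?lines_homog.
  - exact: syzygy_coordinates.
  - exact: no_unit_relation.
apply: ord3P => /=; last first.
- rewrite -(prednK (n := (size gs + size hs)%N)); last by rewrite addn_gt0 gs_gt0.
  apply: pencil_syzygy_homog; rewrite prednK; last by rewrite addn_gt0 gs_gt0.
  by apply: dhomogM; apply: prod_forms_homog.
- apply: pencil_syzygy_homog; rewrite /Ks /= -[(size gs).+2]/(1 + 1 + size gs)%N.
  apply: dhomogM; last exact: prod_forms_homog.
  by apply: dhomogM; apply: lines_homog.
- apply: pencil_syzygy_homog; rewrite /Ks /= -[(size hs).+2]/(1 + 1 + size hs)%N.
  apply: dhomogM; last exact: prod_forms_homog.
  by apply: dhomogM; apply: lines_homog.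
Qed.

End NormalizedPencils.

(** The centres v1 and v2 are rescaled so that x and y are coordinates. *)
Lemma two_pencils_exponents (lam x y : S) (gs hs : seq S) (v1 v2 v3 : 'rV[C]_3) :
  let lines := [:: lam, x, y & gs ++ hs] in
  {in lines, forall l, l \is 1.-homog} -> uniq lines ->
  {in lines &, forall l k, l != k ->
    exists2 v : 'rV[C]_3, l.@[v 0] = 0 & k.@[v 0] != 0} ->
  v3 != 0 ->
  [/\ lam.@[v1 0] != 0, lam.@[v2 0] != 0 & lam.@[v3 0] = 0] ->
  [/\ x.@[v1 0] != 0, x.@[v2 0] = 0 & x.@[v3 0] = 0] ->
  [/\ y.@[v1 0] = 0, y.@[v2 0] != 0 & y.@[v3 0] = 0] ->
  {in gs, forall g, [/\ g.@[v1 0] != 0, g.@[v2 0] = 0 & g.@[v3 0] != 0]} ->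
  {in hs, forall h, [/\ h.@[v1 0] = 0, h.@[v2 0] != 0 & h.@[v3 0] != 0]} ->
  {in gs & hs, forall g h,
    exists v : 'rV[C]_3, [/\ lam.@[v 0] = 0, g.@[v 0] = 0 & h.@[v 0] != 0]} ->
  (size hs <= size gs)%N -> (2 <= size hs)%N ->
  has_exponents (\prod_(l <- lines) l)
    [:: (size hs).+2; (size gs).+2; (size gs + size hs)%N].
Proof.
move=> lines linesH linesU linesD v30 [lam1 lam2 lam3] [x1 x2 x3] [y1 y2 y3].
move=> gsP hsP generic hg h2.
have lamH : lam \is 1.-homog by apply: linesH; rewrite !inE eqxx.
have xH : x \is 1.-homog by apply: linesH; rewrite !inE eqxx !orbT.
have yH : y \is 1.-homog by apply: linesH; rewrite !inE eqxx !orbT.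
have [z [zH z1 z2 z3]] := dual_form xH yH x1 x2 x3 y1 y2 y3 v30.
have x1' := invr_neq0 x1; have y2' := invr_neq0 y2.
apply: (@normalized_pencils_exponents x y z lam gs hs
  ((x.@[v1 0])^-1 *: v1) ((y.@[v2 0])^-1 *: v2) v3) => //.
- move=> [[|[|[|//]]] jlt] [[|[|[|//]]] klt] /=;
    rewrite ?meval_formZ ?x2 ?x3 ?y1 ?y3 ?z1 ?z2 ?z3 ?mulr0 ?mulVf //;
    by rewrite (inj_eq val_inj).
- by rewrite meval_formZ // mulf_neq0.
- by rewrite meval_formZ // mulf_neq0.
- move=> g ggs; have [g1 g2 g3] := gsP g ggs.
  have gH : g \is 1.-homog by apply: linesH; rewrite !inE mem_cat ggs !orbT.
  by rewrite !meval_formZ // g2 mulr0; split; rewrite ?mulf_neq0.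
- move=> h hhs; have [h1 h2' h3] := hsP h hhs.
  have hH : h \is 1.-homog by apply: linesH; rewrite !inE mem_cat hhs !orbT.
  by rewrite !meval_formZ // h1 mulr0; split; rewrite ?mulf_neq0.
- by rewrite (leq_trans _ hg) // ltnW.
- exact: ltnW.
Qed.

End TwoPencils.

(** * Points and lines of the projective plane *)

Section ProjectivePlane.

Variable C : fieldType.
Implicit Types (p q : ppoint C) (l m : pline C) (v : 'rV[C]_3).

Lemma dim_rV3 : \dim (fullv : {vspace 'rV[C]_3}) = 3%N.
Proof. by rewrite dimvf. Qed.

Definition point_vector p : 'rV[C]_3 := vpick (val p).

Lemma point_vectorE p : val p = <[point_vector p]>%VS.
Proof.
have p0 : point_vector p != 0.
  by rewrite vpick0 -dimv_eq0 (eqP (valP p)).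
apply/esym/eqP; rewrite eqEdim -memvE memv_pick dim_vline p0.
by rewrite (eqP (valP p)).
Qed.

Lemma point_vector_neq0 p : point_vector p != 0.
Proof. by rewrite vpick0 -dimv_eq0 (eqP (valP p)). Qed.

Lemma on_lineE p l : on_line p l = (point_vector p \in val l).
Proof. by rewrite /on_line point_vectorE memvE. Qed.

Lemma dim_span_point v : v != 0 -> \dim <[v]> == 1%N.
Proof. by move=> v0; rewrite dim_vline v0. Qed.

Definition span_point v (v0 : v != 0) : ppoint C :=
  exist _ <[v]>%VS (dim_span_point v0).

Lemma line_sub_eq l m : (val l <= val m)%VS -> l = m.
Proof.
by move=> lm; apply/val_inj/eqP; rewrite eqEdim lm (eqP (valP l)) (eqP (valP m)).
Qed.

Lemma line_vector_off l m : l != m -> exists2 v, v \in val l & v \notin val m.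
Proof.
by move=> lm; apply/subvPn; apply: contra lm => /line_sub_eq ->.
Qed.

Lemma lines_meet l m : exists p, on_line p l && on_line p m.
Proof.
have := dimv_sum_cap (val l) (val m); rewrite (eqP (valP l)) (eqP (valP m)) => dE.
have le3 : (\dim (val l + val m) <= 3)%N 
  by apply: leq_trans (dimvS (subvf _)) _; rewrite dim_rV3.
have cap0 : (val l :&: val m)%VS != 0%VS.
  by rewrite -dimv_eq0; apply: contraTneq le3 => d0; rewrite d0 addn0 in dE; rewrite dE.
rewrite -vpick0 in cap0; exists (span_point cap0).
by rewrite /on_line -subv_cap -memvE memv_pick.
Qed.

Lemma lines_meet_once l m p q : l != m ->
  on_line p l -> on_line p m -> on_line q l -> on_line q m -> p = q.
Proof.
move=> lm pl pm ql qm.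
have cap1 : (\dim (val l :&: val m) <= 1)%N.
  rewrite leqNgt; apply: contra lm => d2; apply/eqP/line_sub_eq.
  suff <- : (val l :&: val m)%VS = val l by apply: capvSr.
  by apply/eqP; rewrite eqEdim capvSl (eqP (valP l)).
have ptE r : on_line r l -> on_line r m -> val r = (val l :&: val m)%VS.
  by move=> rl rm; apply/eqP; rewrite eqEdim subv_cap (eqP (valP r)) cap1 andbT;
    apply/andP.
by apply: val_inj; rewrite (ptE p) ?(ptE q).
Qed.

(** If h vanished at a vector off l, it would vanish on the whole space. *)
Lemma line_equationP l (h : {mpoly C[3]}) v : line_equation l h ->
  (h.@[v 0] == 0) = (v \in val l).
Proof.
move=> [hH h0 hl]; apply/eqP/idP => [hv|]; last exact: hl.
have [w hw] := form_point hH h0; apply: contraTT isT => vNl.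
have full : (val l + <[v]>)%VS = fullv.
  have v0 : v != 0 by apply: contraNneq vNl => ->; apply: mem0v.
  have cap0 : (val l :&: <[v]>)%VS = 0%VS.
    apply/eqP; rewrite -subv0; apply/subvP => t /memv_capP[tl /vlineP[c tE]].
    move: tl; rewrite tE memv0 scaler_eq0; apply: contraTT => /norP[c0 _].
    by rewrite rpredZeq negb_or c0.
  by apply/eqP; rewrite eqEdim subvf dim_rV3 dimv_disjoint_sum // (eqP (valP l))
    dim_vline v0.
have := memvf w; rewrite -full => /memv_addP[u ul [t /vlineP[c ->] wE]].
move: hw; rewrite wE addrC meval_form_linear // hv mulr0 add0r hl // => /eqP.
by rewrite eq_sym oner_eq0.
Qed.

End ProjectivePlane.

(** For u and w spanning l, the points of u + k w, for k in nat, are distinct. *)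
Lemma line_infinite (C : numFieldType) (l : pline C) (P : {fset ppoint C}) :
  exists2 p, on_line p l & p \notin P.
Proof.
have [u ul u0] : exists2 u, u \in val l & u != 0.
  exists (vpick (val l)); first exact: memv_pick.
  by rewrite vpick0 -dimv_eq0 (eqP (valP l)).
have [w wl wNu] : exists2 w, w \in val l & w \notin <[u]>%VS.
  apply/subvPn/negP => /dimvS; rewrite (eqP (valP l)) dim_vline u0.
  by [].
have uw0 (k : nat) : u + k%:R *: w != 0.
  apply: contra wNu => /eqP uw0; have [k0|k0] := eqVneq (k%:R : C) 0.
    by move: u0; rewrite -uw0 k0 scale0r addr0 eqxx.
  apply/vlineP; exists (- k%:R^-1).
  apply: (scalerI k0); rewrite scalerA mulrN mulfV // scaleN1r.
  by apply/eqP; rewrite -addr_eq0 addrC uw0.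
pose pt k := span_point (uw0 k).
have pt_on k : on_line (pt k) l.
  by rewrite /on_line /= -memvE memvD // memvZ.
have pt_inj : injective pt.
  move=> j k /(congr1 val) /= jk.
  have /vlineP[c] : u + j%:R *: w \in <[u + k%:R *: w]>%VS by rewrite -jk memv_line.
  rewrite scalerDr scalerA => /eqP; rewrite -subr_eq0 opprD addrACA -scalerBl.
  rewrite -{1}[u]scale1r -scalerBl => /eqP uwE.
  have jck : j%:R - c * k%:R = 0 :> C.
    apply: contraNeq wNu => ne; apply/vlineP; exists (- (j%:R - c * k%:R)^-1 * (1 - c)).
    apply: (scalerI ne); rewrite scalerA mulrA mulrN mulfV // mulN1r scaleNr.
    by apply/eqP; rewrite -addr_eq0 addrC uwE.
  have c1 : c = 1.
    move: uwE => /eqP; rewrite jck scale0r addr0.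
    by rewrite scaler_eq0 (negbTE u0) orbF subr_eq0 => /eqP.
  by move/eqP: jck; rewrite c1 mul1r subr_eq0 Num.Theory.eqr_nat => /eqP.
have [/allP ptP|/allPn[p]] := boolP (all (mem P) [seq pt k | k <- iota 0 (#|` P|.+1)]).
  have := uniq_leq_size _ ptP; rewrite size_map size_iota map_inj_uniq // iota_uniq.
  by move/(_ isT); rewrite ltnn.
by move=> /mapP[k _ ->] kP; exists (pt k).
Qed.

(** * The triple point and the exponents *)

Local Open Scope fset_scope.

(** This is how the factors of the equation are regrouped: L, the two lines
    through o, and the rest of each pencil. *)
Lemma split_enum_fset (K : choiceType) (B1 B2 : {fset K}) (k k1 k2 : K) :
  (forall l, l \in B1 -> l \notin B2) -> k1 \in B1 -> k2 \in B2 ->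
  k \notin B1 `|` B2 ->
  let ls := [:: k, k2, k1 & enum_fset (B2 `\ k2) ++ enum_fset (B1 `\ k1)] in
  uniq ls /\ ls =i k |` (B1 `|` B2).
Proof.
move=> B12 k1B k2B kNB ls; split; last first.
  move=> l; rewrite !inE mem_cat !inE.
  case: (l == k) => //=; have [->|_] := eqVneq l k2; first by rewrite k2B orbT.
  by have [->|_] := eqVneq l k1; rewrite ?k1B //= orbC.
have k1N := B12 _ k1B; have k2N : k2 \notin B1 by apply: contraL k2B => /B12.
move: kNB; rewrite inE => /norP[kN1 kN2].
have kk2 : k != k2 by apply: contraNneq kN2 => ->.
have kk1 : k != k1 by apply: contraNneq kN1 => ->.
have k21 : k2 != k1 by apply: contraNneq k1N => <-.
rewrite /= !inE !mem_cat !inE cat_uniq !fset_uniq !eqxx !negb_or /= kk2 kk1 k21.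
rewrite (negbTE kN1) (negbTE kN2) (negbTE k1N) (negbTE k2N) !andbF /= andbT.
apply/hasPn => l; rewrite !inE => /andP[_ /B12 lN].
by rewrite (negbTE lN) andbF.
Qed.

Section PencilsAndLine.

Variable C : numFieldType.
Implicit Types (p : ppoint C) (l m : pline C) (B : {fset pline C}).

Definition meet_point L l : ppoint C := xchoose (lines_meet L l).

Lemma meet_point_on L l : on_line (meet_point L l) L /\ on_line (meet_point L l) l.
Proof. exact/andP/(xchooseP (lines_meet L l)). Qed.

Lemma meet_pointE L l p : L != l -> on_line p L -> on_line p l -> p = meet_point L l.
Proof.
move=> Ll pL pl; have [mL ml] := meet_point_on L l.
exact: lines_meet_once Ll pL pl mL ml.
Qed.

Lemma meet_point_inj L a B : ~~ on_line a L ->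
  (forall l, l \in B -> on_line a l) -> {in B &, injective (meet_point L)}.
Proof.
move=> aL Ba l m lB mB lm; apply/eqP; apply: contraNT aL => lNm.
have [pL pl] := meet_point_on L l; have [_ pm] := meet_point_on L m.
by rewrite (lines_meet_once lNm (Ba l lB) (Ba m mB) pl) // lm.
Qed.

Lemma card_meet_points_le1 L a B : on_line a L -> L \notin B ->
  (forall l, l \in B -> on_line a l) -> (#|` meet_point L @` B| <= 1)%N.
Proof.
move=> aL LNB Ba; apply: leq_trans (_ : #|` [fset a]| <= _)%N; last by rewrite cardfs1.
apply: fsubset_leq_card; apply/fsubsetP => p /imfsetP[/= l lB ->].
apply/fset1P; symmetry; apply: (meet_pointE _ aL (Ba l lB)).
by apply: contraNneq LNB => ->.
Qed.

(** The line L meets n_1 + n_2 lines in n_1 + n_2 - 1 points. Since n_1 and n_2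
    are at least 3, this excludes that L contains the centre of a pencil, so
    that each pencil is met in distinct points, and exactly one point lies on a
    line of both pencils. *)
Lemma unique_triple_point (a1 a2 : ppoint C) (n1 n2 : nat) B1 B2 L :
  #|` B1| = n1 -> (forall l, l \in B1 -> on_line a1 l) ->
  #|` B2| = n2 -> (forall l, l \in B2 -> on_line a2 l) ->
  (3 <= n1)%N -> (3 <= n2)%N ->
  (exists2 P : {fset ppoint C}, #|` P| = (n1 + n2 - 1)%N
     & forall p, p \in P <-> on_line p L /\ on_arrangement p (B1 `|` B2)) ->
  [/\ L \notin B1 `|` B2, ~~ on_line a1 L, ~~ on_line a2 L
    & exists l1 l2 o, [/\ l1 \in B1, l2 \in B2,
        [/\ on_line o L, on_line o l1 & on_line o l2]
        & forall g h p, g \in B2 -> h \in B1 -> on_line p L -> on_line p g ->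
            on_line p h -> h = l1]].
Proof.
move=> cB1 B1a cB2 B2a n1_ge3 n2_ge3 [P cP Pp].
have LNB : L \notin B1 `|` B2.
  apply/negP => LB; have [p pL] := line_infinite L P.
  by apply/negP/negPn/(Pp p).2; split=> //; exists L.
have LNB1 : L \notin B1 by apply: contra LNB; rewrite inE => ->.
have LNB2 : L \notin B2 by apply: contra LNB; rewrite inE orbC => ->.
pose Q1 := meet_point L @` B1; pose Q2 := meet_point L @` B2.
have PE : P = Q1 `|` Q2.
  apply/fsetP => p; apply/idP/idP => [/(Pp p).1[pL [l lB pl]]|].
    have Ll : L != l by apply: contraNneq LNB => ->.
    rewrite (meet_pointE Ll pL pl) inE; move: lB; rewrite inE.
    by case/orP => lB; rewrite (in_imfset _ _ lB) ?orbT.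
  rewrite inE => /orP[] /imfsetP[/= l lB ->]; apply/(Pp _).2;
    have [pL pl] := meet_point_on L l; split=> //;
    by exists l; rewrite // inE lB ?orbT.
have cQ : (#|` Q1| + #|` Q2| = n1 + n2 - 1 + #|` Q1 `&` Q2|)%N.
  by rewrite -cardfsUI -PE cP.
have Q1n : (#|` Q1| <= n1)%N by rewrite -cB1; apply: leq_imfset_card.
have Q2n : (#|` Q2| <= n2)%N by rewrite -cB2; apply: leq_imfset_card.
have a1L : ~~ on_line a1 L.
  by apply/negP => /card_meet_points_le1 /(_ LNB1 B1a); rewrite -/Q1; lia.
have a2L : ~~ on_line a2 L.
  by apply/negP => /card_meet_points_le1 /(_ LNB2 B2a); rewrite -/Q2; lia.
have inj1 := meet_point_inj a1L B1a; have inj2 := meet_point_inj a2L B2a.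
have cQ1 : #|` Q1| = n1 by rewrite -cB1; apply: card_in_imfset.
have cQ2 : #|` Q2| = n2 by rewrite -cB2; apply: card_in_imfset.
have /eqP : #|` Q1 `&` Q2| = 1%N by lia.
case/cardfs1P => o oE; split=> //.
have := fset11 o; rewrite -oE inE.
case/andP=> /imfsetP[/= l1 l1B oE1] /imfsetP[/= l2 l2B oE2].
exists l1, l2, o; split=> //.
  have [oL ol1] := meet_point_on L l1; have [_ ol2] := meet_point_on L l2.
  by split; rewrite ?oE1 // -oE1 oE2.
move=> g h p gB hB pL pg ph; apply: inj1 => //.
have pEh : p = meet_point L h.
  by apply: meet_pointE => //; apply: contraNneq LNB1 => ->.
have pEg : p = meet_point L g.
  by apply: meet_pointE => //; apply: contraNneq LNB2 => ->.
rewrite -oE1 -pEh; apply/fset1P; rewrite -oE inE; apply/andP; split.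
  by rewrite pEh in_imfset.
by rewrite pEg in_imfset.
Qed.

Lemma pencils_and_line_exponents (a1 a2 : ppoint C) (n1 n2 : nat) B1 B2 L f :
  #|` B1| = n1 -> (forall l, l \in B1 -> on_line a1 l) ->
  #|` B2| = n2 -> (forall l, l \in B2 -> on_line a2 l) ->
  (forall l, l \in B1 -> ~~ on_line a2 l) ->
  (forall l, l \in B2 -> ~~ on_line a1 l) ->
  (3 <= n1)%N -> (n1 <= n2)%N ->
  (exists2 P : {fset ppoint C}, #|` P| = (n1 + n2 - 1)%N
     & forall p, p \in P <-> on_line p L /\ on_arrangement p (B1 `|` B2)) ->
  arrangement_equation (L |` (B1 `|` B2)) f ->
  has_exponents f [:: n1 + 1; n2 + 1; n1 + n2 - 2]%N /\
  msize f = (n1 + n2 + 2)%N.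
Proof.
move=> cB1 B1a1 cB2 B2a2 B1a2 B2a1 n1_ge3 n12 card_L [h hP fE].
have n2_ge3 := leq_trans n1_ge3 n12.
have [LNB a1L a2L [l1 [l2 [o [l1B l2B [oL ol1 ol2] generic]]]]] :=
  unique_triple_point cB1 B1a1 cB2 B2a2 n1_ge3 n2_ge3 card_L.
have B12 l : l \in B1 -> l \notin B2.
  by move=> lB1; apply/negP => /B2a1; rewrite (B1a1 l lB1).
pose ls := [:: L, l2, l1 & enum_fset (B2 `\ l2) ++ enum_fset (B1 `\ l1)].
have [lsU lsA] : uniq ls /\ ls =i L |` (B1 `|` B2) by apply: split_enum_fset.
have hls l : l \in ls -> line_equation l (h l) by rewrite lsA; apply: hP.
have off l m : l \in ls -> m \in ls -> l != m ->
    exists2 v : 'rV[C]_3, (h l).@[v 0] = 0 & (h m).@[v 0] != 0.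
  move=> lls mls /line_vector_off[v vl vm]; exists v.
    by apply/eqP; rewrite (line_equationP _ (hls l lls)).
  by rewrite (line_equationP _ (hls m mls)).
have hinj : {in ls &, injective h}.
  move=> l m lls mls hlm; apply/eqP/negPn/negP => /(off l m lls mls)[v].
  by rewrite hlm => ->; rewrite eqxx.
have val0 l p : l \in ls -> on_line p l -> (h l).@[(point_vector p) 0] = 0.
  by move=> lls pl; apply/eqP; rewrite (line_equationP _ (hls l lls)) -on_lineE.
have valN0 l p : l \in ls -> ~~ on_line p l -> (h l).@[(point_vector p) 0] != 0.
  by move=> lls pl; rewrite (line_equationP _ (hls l lls)) -on_lineE.
have Lls : L \in ls by rewrite lsA fset1U1.
have B1ls l : l \in B1 -> l \in ls by move=> lB; rewrite lsA fset1Ur // in_fsetU lB.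
have B2ls l : l \in B2 -> l \in ls.
  by move=> lB; rewrite lsA fset1Ur // in_fsetU lB orbT.
have [gs gsE] : {gs | gs = [seq h g | g <- enum_fset (B2 `\ l2)]} 
  by exact: exist _ _ erefl.
have [hs hsE] : {hs | hs = [seq h l | l <- enum_fset (B1 `\ l1)]} 
  by exact: exist _ _ erefl.
have linesE : [:: h L, h l2, h l1 & gs ++ hs] = map h ls.
  by rewrite /ls /= map_cat gsE hsE.
have sgs : size gs = n2.-1.
  by rewrite gsE size_map -[size _]/(#|` B2 `\ l2|) -cB2 [in RHS](cardfsD1 l2) l2B.
have shs : size hs = n1.-1.
  by rewrite hsE size_map -[size _]/(#|` B1 `\ l1|) -cB1 [in RHS](cardfsD1 l1) l1B.
have {}fE : f = \prod_(l <- [:: h L, h l2, h l1 & gs ++ hs]) l.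
  rewrite linesE big_map fE; apply: perm_big.
  by apply: uniq_perm => // l; rewrite lsA.
have linesH : {in [:: h L, h l2, h l1 & gs ++ hs], forall k, k \is 1.-homog}.
  by rewrite linesE => k /mapP[l lls ->]; have [] := hls l lls.
have lines0 : {in [:: h L, h l2, h l1 & gs ++ hs], forall k, k != 0}.
  by rewrite linesE => k /mapP[l lls ->]; have [] := hls l lls.
split; last first.
  rewrite fE (msize_prod_forms linesH lines0) /= size_cat sgs shs.
  by clear -n1_ge3 n12; lia.
have -> : [:: n1 + 1; n2 + 1; n1 + n2 - 2]%N =
    [:: (size hs).+2; (size gs).+2; (size gs + size hs)%N].
  by rewrite sgs shs; clear -n1_ge3 n12; congr [:: _; _; _]; lia.
have oN l m a : l != m -> on_line a l -> on_line a m -> ~~ on_line a L ->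
    on_line o m -> ~~ on_line o l.
  move=> lm al am aL om; apply/negP => ol.
  by move/negP: aL; apply; rewrite (lines_meet_once lm al am ol om).
rewrite fE; apply: (two_pencils_exponents (v1 := point_vector a1)
  (v2 := point_vector a2) (v3 := point_vector o)) => //.
- by rewrite linesE map_inj_in_uniq.
- rewrite linesE => _ _ /mapP[l lls ->] /mapP[m mls ->] lm.
  by apply: off => //; apply: contraNneq lm => ->.
- exact: point_vector_neq0.
- by split; [apply: valN0|apply: valN0|apply: val0].
- by split; [apply: valN0|apply: val0|apply: val0]; auto.
- by split; [apply: val0|apply: valN0|apply: val0]; auto.
- rewrite gsE => _ /mapP[g /fsetD1P[gl2 gB] ->].
  split; [apply: valN0|apply: val0|apply: valN0]; auto.
  (* A line of the second pencil through o would coincide with l2. *)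
  exact: (oN g l2 a2) (B2a2 g gB) (B2a2 l2 l2B) _ _.
- rewrite hsE => _ /mapP[l /fsetD1P[ll1 lB] ->].
  split; [apply: val0|apply: valN0|apply: valN0]; auto.
  exact: (oN l l1 a1) (B1a1 l lB) (B1a1 l1 l1B) _ _.
- rewrite gsE hsE => _ _ /mapP[g /fsetD1P[gl2 gB] ->] /mapP[l /fsetD1P[ll1 lB] ->].
  have [pL pg] := meet_point_on L g.
  exists (point_vector (meet_point L g)).
  split; [apply: val0|apply: val0|apply: valN0]; auto.
  by apply: contra ll1 => pl; apply/eqP; apply: (generic g l _ gB lB pL pg pl).
- by rewrite sgs shs; clear -n12; lia.
- by rewrite shs; clear -n1_ge3; lia.
Qed.

End PencilsAndLine.

Theorem theorem1p20 (R : realType) (a1 a2 : ppoint R[i]) (n1 n2 : nat)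
    (B1 B2 : {fset pline R[i]}) (L : pline R[i])
    (a1_neq_a2 : a1 != a2)
    (card_B1 : #|` B1| = n1)
    (B1_a1 : forall l, l \in B1 -> on_line a1 l)
    (card_B2 : #|` B2| = n2)
    (B2_a2 : forall l, l \in B2 -> on_line a2 l)
    (B1_a2 : forall l, l \in B1 -> ~~ on_line a2 l)
    (B2_a1 : forall l, l \in B2 -> ~~ on_line a1 l)
    (n1_ge3 : (3 <= n1)%N) (n1_le_n2 : (n1 <= n2)%N)
    (card_L : exists2 P : {fset ppoint R[i]}, #|` P| = (n1 + n2 - 1)%N
      & forall p, p \in P <-> on_line p L /\ on_arrangement p (B1 `|` B2))
    (f : {mpoly R[i][3]})
    (f_eq : arrangement_equation (L |` (B1 `|` B2)) f) :
  has_type_2A f /\ has_exponents f [:: n1 + 1; n2 + 1; n1 + n2 - 2]%N.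
Proof.
have [exps fsize] := pencils_and_line_exponents card_B1 B1_a1 card_B2 B2_a2
  B1_a2 B2_a1 n1_ge3 n1_le_n2 card_L f_eq.
split=> //; split; last by exists [:: n1 + 1; n2 + 1; n1 + n2 - 2]%N.
exists (n1 + 1)%N, (n2 + 1)%N, [:: (n1 + n2 - 2)%N]; split=> //.
by rewrite fsize; lia.
Qed.
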